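(* Let $d \geq 1$. Then for any integers $k,\ell \geq 0$ with $k+\ell \leq d-1$, there exist integral convex polytopes $\mathcal{P}, \mathcal{Q}\subset\mathbb{R}^d$ of dimension $d$ such that: (i) for $t=1,\ldots,k$, $i(\mathcal{P},t)=i(\mathcal{Q},t)$; (ii) for $t=1,\ldots,\ell$, $i^*(\mathcal{P},t)=i^*(\mathcal{Q},t)$; (iii) $i(\mathcal{P},k+1) \neq i(\mathcal{Q},k+1)$ and $i^*(\mathcal{P},\ell+1)\neq i^*(\mathcal{Q},\ell+1)$.
   Context: An integral convex polytope is a convex polytope all of whose vertices have integer coordinates. For an integral convex polytope $\mathcal{P}\subset\mathbb{R}^d$ with boundary $\partial\mathcal{P}$ and integer $n\ge1$, $i(\mathcal{P},n)=|n\mathcal{P}\cap\mathbb{Z}^d|$ and $i^*(\mathcal{P},n)=|n(\mathcal{P}\setminus\partial\mathcal{P})\cap\mathbb{Z}^d|$, where $n\mathcal{P}=\{n\alpha:\alpha\in\mathcal{P}\}$. *)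

(* Defs.v *)
From HB Require Import structures.
From mathcomp Require Import all_boot all_order all_algebra finmap.
From mathcomp Require Import all_classical all_reals all_analysis.

Set Implicit Arguments.
Unset Strict Implicit.
Unset Printing Implicit Defensive.

Import Order.TTheory GRing.Theory Num.Theory.
Import numFieldNormedType.Exports.

Local Open Scope classical_set_scope.
Local Open Scope ring_scope.

(* Subsets of R^d are sets of row vectors 'rV[R]_d. *)

Definition convex_hull (R : realType) (d : nat) (A : set 'rV[R]_d) :
    set 'rV[R]_d :=
  smallest (@convex_set R 'rV[R]_d) A.

Definition convex_polytope (R : realType) (d : nat) (P : set 'rV[R]_d) : Prop :=
  exists A : set 'rV[R]_d, finite_set A /\ P = convex_hull A.

(* The vertices of a convex polytope are its extreme points. *)
Definition is_vertex (R : realType) (d : nat) (P : set 'rV[R]_d)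
    (v : 'rV[R]_d) : Prop :=
  P v /\ forall (x y : 'rV[R]_d) (t : R), P x -> P y -> 0 < t < 1 ->
           v = t *: x + (1 - t) *: y -> x = v /\ y = v.

Definition lattice (R : realType) (d : nat) : set 'rV[R]_d :=
  [set x | forall j, x ord0 j \is a Num.int].

Definition integral_convex_polytope (R : realType) (d : nat)
    (P : set 'rV[R]_d) : Prop :=
  convex_polytope P /\ is_vertex P `<=` @lattice R d.

Definition translate (R : realType) (d : nat) (x : 'rV[R]_d)
    (U : {vspace 'rV[R]_d}) : set 'rV[R]_d :=
  [set x + u | u in [set` U]].

Definition affine_subspace (R : realType) (d : nat) (F : set 'rV[R]_d) : Prop :=
  exists (x : 'rV[R]_d) (U : {vspace 'rV[R]_d}), F = translate x U.

Definition affine_hull (R : realType) (d : nat) (A : set 'rV[R]_d) :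
    set 'rV[R]_d :=
  smallest (@affine_subspace R d) A.

Definition has_dim (R : realType) (d : nat) (A : set 'rV[R]_d) (m : nat) :
    Prop :=
  exists (x : 'rV[R]_d) (U : {vspace 'rV[R]_d}),
    affine_hull A = translate x U /\ \dim U = m.

(* Topological boundary in R^d. For a polytope of dimension d this is the union
   of its proper faces; for a lower-dimensional one it is not the relative
   boundary. *)
Definition boundary (R : realType) (d : nat) (A : set 'rV[R]_d) :
    set 'rV[R]_d :=
  closure A `\` A°.

Definition dilate (R : realType) (d : nat) (n : nat) (A : set 'rV[R]_d) :
    set 'rV[R]_d :=
  [set n%:R *: x | x in A].

(* fset_set sends an infinite set to fset0, but here it is only applied to the
   lattice points of a bounded set when A is a polytope. *)
Definition lattice_count (R : realType) (d : nat) (A : set 'rV[R]_d) : nat :=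
  #|` fset_set (A `&` @lattice R d)|.

Definition ehrhart (R : realType) (d : nat) (P : set 'rV[R]_d) (n : nat) : nat :=
  lattice_count (dilate n P).

Definition ehrhart_int (R : realType) (d : nat) (P : set 'rV[R]_d) (n : nat) :
    nat :=
  lattice_count (dilate n (P `\` boundary P)).

(* Main.v *)
(** Let [S_m] be the simplex with vertices [e_1, ..., e_d] and
    [v_m = - (e_1 + ... + e_m)]; its h*-vector is [1 + t + ... + t^m], and we
    take [P = S_k] and [Q = S_(d-l)].  A lattice point of [t S_m] has apex
    coordinate [q + c / (m+1)] with [0 <= c <= m]; once [q] and [c] are fixed,
    the remaining conditions are integral and do not involve [m], up to the
    translation of [x] by [q (e_1 + ... + e_m)].  So for [a <= b] the lattice
    points of [t S_a] inject into those of [t S_b], with image the points of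
    residue [c <= a]; since [c <= t], nothing is missed for [t <= a], whereas
    for [t = a + 1] the origin, with [c = a + 1], is.  As for the interiors,
    the last [d - m] coordinates of an interior lattice point of [t S_m] are at
    least [1], which forces [t > d - m], and [e_(m+1) + ... + e_d] is interior
    to [(d - m + 1) S_m]. *)

Require Import Defs.
From HB Require Import structures.
From mathcomp Require Import all_boot all_order all_algebra finmap.
From mathcomp Require Import all_classical all_reals all_analysis.
From mathcomp Require Import ring lra.

Set Implicit Arguments.
Unset Strict Implicit.
Unset Printing Implicit Defensive.

Import Order.TTheory GRing.Theory Num.Theory.
Import numFieldNormedType.Exports.

Local Open Scope classical_set_scope.
Local Open Scope ring_scope.

(** * Convex combinations and extreme points *)

Lemma convex_setP (R : realType) (M : lmodType R) (A : set M) :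
  @convex_set R M A <->
  (forall (x y : M) (t : R), A x -> A y -> 0 <= t <= 1 ->
     A (t *: x + (1 - t) *: y)).
Proof.
split=> [cA x y t Ax Ay /andP[t0 t1] | cA x y t].
  by have := cA x y (Itv01 t0 t1); rewrite !inE => /(_ Ax Ay).
rewrite !inE => Ax Ay; apply: cA => //.
by rewrite ge0 le1.
Qed.

(** Induction on the list, merging the head with the normalised combination of the tail. Dividing by
    the total weight, instead of asking it to be 1, lets the hypothesis pass to the tail. *)
Lemma convex_set_sum (R : realType) (M : lmodType R) (A : set M)
    (I : Type) (r : seq I) (a : I -> R) (p : I -> M) :
  @convex_set R M A -> (forall i, 0 <= a i) -> (forall i, A (p i)) ->
  0 < \sum_(i <- r) a i ->
  A ((\sum_(i <- r) a i)^-1 *: \sum_(i <- r) a i *: p i).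
Proof.
move=> /convex_setP cA a0 Ap; elim: r => [|i r IHr]; first by rewrite big_nil ltxx.
rewrite !big_cons; set s := \sum_(j <- r) a j => s0.
have : 0 <= s by exact: sumr_ge0.
(* A tail of total weight 0 cannot be normalised; all its weights vanish, and only the head
   remains. *)
rewrite le_eqVlt => /predU1P[s_eq0 | s_gt0].
  have -> : \sum_(j <- r) a j *: p j = 0.
    suff all0 : all (fun j => a j == 0) r.
      elim: r all0 {IHr s s0 s_eq0} => [|j r IHr] /=; first by rewrite big_nil.
      by case/andP=> /eqP aj0 /IHr; rewrite big_cons aj0 scale0r add0r.
    elim: r {IHr s0} @s s_eq0 => [//|j r IHr] /=; rewrite big_cons.
    move/esym/eqP; rewrite paddr_eq0 ?sumr_ge0// => /andP[-> /eqP r0] /=.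
    exact: IHr.
  move: s0; rewrite -s_eq0 !addr0 => ai0.
  by rewrite scalerA mulVf ?gt_eqF// scale1r.
have := cA _ _ (a i / (a i + s)) (Ap i) (IHr s_gt0).
have -> : 1 - a i / (a i + s) = s / (a i + s) by field; rewrite gt_eqF.
rewrite scalerA scalerDr !scalerA [s / _ * _]mulrAC mulfV ?gt_eqF// mul1r.
rewrite [a i / _]mulrC; apply.
rewrite mulr_ge0 ?a0 ?invr_ge0 ?(ltW s0)//= mulrC.
by rewrite ler_pdivrMr // mul1r lerDl ltW.
Qed.

(* Removing an extreme point from a convex set leaves a convex set. *)
Lemma vertex_convex_hull (R : realType) (d : nat) (A : set 'rV[R]_d) :
  is_vertex (convex_hull A) `<=` A.
Proof.
move=> v [Hv vP]; apply: contrapT => nAv.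
have : convex_hull A `<=` convex_hull A `\ v.
  apply: smallest_sub => [|x Ax]; last first.
    by split; [exact: sub_smallest Ax | move=> /= xv; apply: nAv; rewrite -xv].
  have cH : @convex_set R 'rV[R]_d (convex_hull A).
    by apply/convex_setP => x y t Hx Hy t01 B [cB AB];
      apply: (convex_setP B).1 => //; [exact: Hx | exact: Hy].
  apply/convex_setP => x y t [Hx xv] [Hy yv] /andP[t0 t1].
  split; first by apply: (convex_setP _).1 => //; rewrite t0.
  move=> /= /esym vE.
  move: t0 vE; rewrite le_eqVlt => /predU1P[<-|t0].
    by rewrite scale0r add0r subr0 scale1r => vy; apply: yv.
  move: t1; rewrite le_eqVlt => /predU1P[->|t1].
    by rewrite subrr scale0r addr0 scale1r => vx; apply: xv.
  move=> vE; have [|xE _] := vP x y t Hx Hy _ vE; first by rewrite t0.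
  exact: xv.
by move=> /(_ v Hv) [_]; apply.
Qed.

(** * The simplices [S_m] in barycentric coordinates *)

(* Up to homogeneity in [t], [apex_coord] and [base_coord] are the barycentric
   coordinates with respect to [v_m] and the [e_i]. *)
Definition apex_coord (R : realType) (d m : nat) (t : R) (x : 'rV[R]_d) : R :=
  (t - \sum_i x ord0 i) / m.+1%:R.

Definition base_coord (R : realType) (d m : nat) (t : R) (x : 'rV[R]_d)
    (i : 'I_d) : R :=
  x ord0 i + (i < m)%:R * apex_coord m t x.

Definition apex (R : realType) (d m : nat) : 'rV[R]_d := \row_i - (i < m)%:R.

Definition vertices (R : realType) (d m : nat) : set 'rV[R]_d :=
  apex R d m |` range (fun i : 'I_d => delta_mx ord0 i).

(** The dilate [t S_m] given by inequalities. Signs suffice: by [sum_base_coord] the coordinates add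
    up to [t] when [m <= d]. *)
Definition simplex (R : realType) (d m : nat) (t : R) : set 'rV[R]_d :=
  [set x | 0 <= apex_coord m t x /\ forall i, 0 <= base_coord m t x i].

Definition open_simplex (R : realType) (d m : nat) (t : R) : set 'rV[R]_d :=
  [set x | 0 < apex_coord m t x /\ forall i, 0 < base_coord m t x i].

Lemma sum_ltn_ord (R : realType) (d m : nat) : (m <= d)%N ->
  \sum_(i < d) (i < m)%:R = m%:R :> R.
Proof.
move=> md; rewrite -natr_sum; congr _%:R.
rewrite -[RHS]card_ord -sum1_card (big_ord_widen d (fun=> 1%N) md).
by rewrite [RHS]big_mkcond; apply: eq_bigr => i _; case: ltnP.
Qed.

Lemma sum_base_coord (R : realType) (d m : nat) (t : R) (x : 'rV[R]_d) :
  (m <= d)%N -> apex_coord m t x + \sum_i base_coord m t x i = t.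
Proof.
move=> md; rewrite big_split/= -mulr_suml sum_ltn_ord// /apex_coord.
rewrite -natr1; field.
by rewrite natr1 pnatr_eq0.
Qed.

Lemma simplex_combination (R : realType) (d m : nat) (t : R) (x : 'rV[R]_d) :
  x = apex_coord m t x *: apex R d m +
      \sum_i base_coord m t x i *: delta_mx ord0 i.
Proof.
apply/rowP => j; rewrite !mxE summxE (bigD1 j)//= big1 => [|i ij].
  by rewrite !mxE !eqxx /base_coord mulr1 addr0; ring.
by rewrite !mxE [j == i]eq_sym (negPf ij) andbF mulr0.
Qed.

(** Joint affinity in the factor and the point. The coefficient [a] ranges over all of [R], since
    [interior_simplex] extrapolates with [a = 1 + e]. *)
Lemma apex_coord_conv (R : realType) (d m : nat) (a s t : R) (x y : 'rV[R]_d) :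
  apex_coord m (a * s + (1 - a) * t) (a *: x + (1 - a) *: y) =
  a * apex_coord m s x + (1 - a) * apex_coord m t y.
Proof.
rewrite /apex_coord.
have -> : \sum_i (a *: x + (1 - a) *: y) ord0 i =
    a * \sum_i x ord0 i + (1 - a) * \sum_i y ord0 i.
  by rewrite !mulr_sumr -big_split; apply: eq_bigr => i _; rewrite !mxE.
by ring.
Qed.

Lemma base_coord_conv (R : realType) (d m : nat) (a s t : R) (x y : 'rV[R]_d) i :
  base_coord m (a * s + (1 - a) * t) (a *: x + (1 - a) *: y) i =
  a * base_coord m s x i + (1 - a) * base_coord m t y i.
Proof. by rewrite /base_coord apex_coord_conv !mxE; ring. Qed.

Lemma convex_hull_vertices (R : realType) (d m : nat) : (m <= d)%N ->
  convex_hull (@vertices R d m) = simplex m 1.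
Proof.
move=> md; apply/seteqP; split.
  apply: smallest_sub => [|x].
    apply/convex_setP => x y t [x0 xi0] [y0 yi0] /andP[t0 t1].
    have E : t * 1 + (1 - t) * 1 = 1 by ring.
    split=> [|i].
      have := apex_coord_conv m t 1 1 x y; rewrite E => ->.
      by rewrite addr_ge0// mulr_ge0// subr_ge0.
    have := base_coord_conv m t 1 1 x y i; rewrite E => ->.
    by rewrite addr_ge0// mulr_ge0// subr_ge0.
  case=> [->|[i _ <-]].
    have E : apex_coord m 1 (apex R d m) = 1.
      rewrite /apex_coord (eq_bigr (fun i : 'I_d => - (i < m)%:R)).
        by rewrite sumrN sum_ltn_ord// opprK addrC natr1 mulfV// gt_eqF.
      by move=> i _; rewrite mxE.
    by split=> [|i]; rewrite ?/base_coord E // !mxE mulr1 addNr.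
  have E : apex_coord m 1 (delta_mx ord0 i : 'rV[R]_d) = 0.
    rewrite /apex_coord (bigD1 i)//= big1 => [|j ji].
      by rewrite mxE !eqxx addr0 subrr mul0r.
    by rewrite mxE (negPf ji) andbF.
  by split=> [|j]; rewrite ?/base_coord E // mulr0 addr0 mxE ler0n.
move=> x [x0 xi0] B [cB AB].
(* The generators are indexed by [option 'I_d], with [None] for the apex; [x] is their combination
   with its own barycentric coordinates as weights, of total 1. *)
pose a o := if o is Some i then base_coord m 1 x i else apex_coord m 1 x.
pose p o : 'rV[R]_d := if o is Some i then delta_mx ord0 i else apex R d m.
have := @convex_set_sum R _ B _ (None :: [seq Some i | i <- index_enum 'I_d]) a p cB.
rewrite !big_cons !big_map /= sum_base_coord// -simplex_combination.
rewrite invr1 scale1r; apply => //.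
- by case.
- by case=> [i|]; apply: AB; [right; exists i | left].
Qed.

Lemma affine_hull_vertices (R : realType) (d m : nat) (P : set 'rV[R]_d) :
  (m <= d)%N -> @vertices R d m `<=` P -> affine_hull P = setT.
Proof.
move=> md vP; apply/seteqP; split=> // z _ F [[x [U ->]] PF].
have {PF} vF : @vertices R d m `<=` translate x U by exact: subset_trans PF.
have [v /= vU vE] := vF (apex R d m) (or_introl erefl).
have eU i : delta_mx ord0 i - apex R d m \in U.
  have [u /= uU uE] := vF (delta_mx ord0 i) (or_intror (ex_intro2 _ _ i I erefl)).
  by rewrite -uE -vE opprD addrACA subrr add0r rpredB.
exists (z - x); last by rewrite addrC subrK.
(* With [t = 0] the coordinates of the vector [z - x] add up to 0, so it is a combination of the
   edges [e_i - v_m], which lie in [U]. *)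
have := sum_base_coord 0 (z - x) md => /eqP; rewrite addr_eq0 => /eqP b0.
rewrite /= [z - x](simplex_combination m 0) b0 scaleNr scaler_suml addrC -sumrB.
by apply: rpred_sum => i _; rewrite -scalerBr rpredZ.
Qed.

(** * Dilates *)

Lemma apex_coordZ (R : realType) (d m : nat) (c t : R) (x : 'rV[R]_d) :
  apex_coord m (c * t) (c *: x) = c * apex_coord m t x.
Proof.
rewrite /apex_coord mulrA mulrBr mulr_sumr; congr ((_ - _) / _).
by apply: eq_bigr => i _; rewrite mxE.
Qed.

Lemma base_coordZ (R : realType) (d m : nat) (c t : R) (x : 'rV[R]_d) i :
  base_coord m (c * t) (c *: x) i = c * base_coord m t x i.
Proof. by rewrite /base_coord apex_coordZ mxE; ring. Qed.

Lemma simplexZ (R : realType) (d m : nat) (c t : R) (x : 'rV[R]_d) : 0 < c ->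
  simplex m (c * t) (c *: x) <-> simplex m t x.
Proof.
move=> c0; rewrite /simplex /= apex_coordZ pmulr_rge0//.
by split=> -[x0 xi0]; split=> // i; move: (xi0 i); rewrite base_coordZ pmulr_rge0.
Qed.

Lemma open_simplexZ (R : realType) (d m : nat) (c t : R) (x : 'rV[R]_d) :
  0 < c -> open_simplex m (c * t) (c *: x) <-> open_simplex m t x.
Proof.
move=> c0; rewrite /open_simplex /= apex_coordZ pmulr_rgt0//.
by split=> -[x0 xi0]; split=> // i; move: (xi0 i); rewrite base_coordZ pmulr_rgt0.
Qed.

Lemma dilateE (R : realType) (d t : nat) (A : set 'rV[R]_d) (x : 'rV[R]_d) :
  (0 < t)%N -> dilate t A x <-> A (t%:R^-1 *: x).
Proof.
move=> t0; have tn0 : t%:R != 0 :> R by rewrite pnatr_eq0 -lt0n.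
split=> [[y Ay <-]|Ax]; first by rewrite scalerA mulVf// scale1r.
by exists (t%:R^-1 *: x) => //; rewrite scalerA mulfV// scale1r.
Qed.

Lemma dilate_simplex (R : realType) (d m t : nat) : (0 < t)%N ->
  dilate t (simplex m 1) = simplex m t%:R :> set 'rV[R]_d.
Proof.
move=> t0; have tp : 0 < t%:R :> R by rewrite ltr0n.
apply/funext => x; apply/propext; rewrite dilateE//.
rewrite -(simplexZ m 1 (t%:R^-1 *: x) tp).
by rewrite scalerA mulfV ?gt_eqF// scale1r mulr1.
Qed.

Lemma dilate_open_simplex (R : realType) (d m t : nat) : (0 < t)%N ->
  dilate t (open_simplex m 1) = open_simplex m t%:R :> set 'rV[R]_d.
Proof.
move=> t0; have tp : 0 < t%:R :> R by rewrite ltr0n.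
apply/funext => x; apply/propext; rewrite dilateE//.
rewrite -(open_simplexZ m 1 (t%:R^-1 *: x) tp).
by rewrite scalerA mulfV ?gt_eqF// scale1r mulr1.
Qed.

(** * Interiors of the simplices *)

Definition first_interior_point (R : realType) (d m : nat) : 'rV[R]_d :=
  \row_i (m <= i)%:R.

(** The apex coordinate and the first [m] base coordinates equal [1 / (m+1)]; the other base
    coordinates equal 1. *)
Lemma first_interior_pointP (R : realType) (d m : nat) : (m <= d)%N ->
  open_simplex m (d - m).+1%:R (first_interior_point R d m).
Proof.
move=> md.
have bE : apex_coord m (d - m).+1%:R (first_interior_point R d m) = m.+1%:R^-1.
  rewrite /apex_coord (eq_bigr (fun i : 'I_d => 1 - (i < m)%:R)).
    rewrite sumrB sum_ltn_ord// sumr_const card_ord -natrB// -natr1.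
    by rewrite addrAC subrr add0r mul1r.
  by move=> i _; rewrite mxE ltnNge; case: (m <= i)%N; rewrite ?subr0 ?subrr.
split=> [|i]; first by rewrite bE invr_gt0 ltr0n.
rewrite /base_coord bE mxE ltnNge; case: (m <= i)%N; rewrite /= ?mul0r ?addr0//.
Qed.

Lemma cvg_apex_coord (R : realType) (d m : nat) (t : R)
    (F : set_system 'rV[R]_d) (FF : Filter F) (x : 'rV[R]_d) :
  (forall i, y ord0 i @[y --> F] --> x ord0 i) ->
  apex_coord m t y @[y --> F] --> apex_coord m t x.
Proof.
move=> Fx; rewrite /apex_coord; apply: cvgMr_tmp; apply: cvgB.
  exact: cvg_cst.
apply: cvg_big => [|i _]; last exact: Fx.
exact: add_continuous.
Qed.

Lemma cvg_base_coord (R : realType) (d m : nat) (t : R)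
    (F : set_system 'rV[R]_d) (FF : Filter F) (x : 'rV[R]_d) j :
  (forall i, y ord0 i @[y --> F] --> x ord0 i) ->
  base_coord m t y j @[y --> F] --> base_coord m t x j.
Proof.
move=> Fx; apply: cvgD; first exact: Fx.
by apply: cvgMl_tmp; exact: cvg_apex_coord.
Qed.

(* An interior point [x] can be pushed slightly away from a point [p] of
   the open simplex without leaving the simplex, so each barycentric coordinate
   of [x] exceeds a positive multiple of that of [p]. *)
Lemma interior_simplex (R : realType) (d m : nat) : (m <= d)%N ->
  (simplex m 1)° = open_simplex m 1 :> set 'rV[R]_d.
Proof.
move=> md; apply/seteqP; split=> x; last first.
  (* Finitely many continuous coordinates, positive at [x], stay non-negative near [x]. *)
  move=> [x0 xi0]; rewrite /interior /=.
  have Fx i : (y : 'rV[R]_d) ord0 i @[y --> nbhs x] --> x ord0 i by exact: coord_continuous.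
  have FF : Filter (nbhs x) by exact: nbhs_filter.
  have Hb := @cvgr_ge _ _ _ FF _ _ (@cvg_apex_coord _ _ m 1 _ FF _ Fx) _ x0.
  have Ha : \forall y \near x, forall i : 'I_d, 0 <= base_coord m 1 y i.
    apply: (@filter_forall _ _ _ (nbhs x) FF) => i.
    exact: (@cvgr_ge _ _ _ FF _ _ (@cvg_base_coord _ _ m 1 _ FF _ i Fx)) (xi0 i).
  exact: (@filterS2 _ _ FF _ _ _ (fun y yb ya => conj yb ya) Hb Ha).
have [p pS] : exists p : 'rV[R]_d, open_simplex m 1 p.
  exists ((d - m).+1%:R^-1 *: first_interior_point R d m).
  have := first_interior_pointP R md.
  by rewrite -dilate_open_simplex// dilateE.
have [p0 pi0] := pS => /= xS.
pose y e : 'rV[R]_d := (1 + e) *: x + (1 - (1 + e)) *: p.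
have : \forall e \near (0 : R)^'+, simplex m 1 (y e).
  have y0E : y 0 = x by rewrite /y addr0 scale1r subrr scale0r addr0.
  suff : y e @[e --> (0 : R)^'+] --> y 0 by rewrite y0E => /(_ _ xS).
  apply: cvg_at_right_filter; apply: cvgD.
    by apply: cvgZr_tmp; apply: cvgD; [exact: cvg_cst | exact: cvg_id].
  apply: cvgZr_tmp; apply: cvgB; first exact: cvg_cst.
  by apply: cvgD; [exact: cvg_cst | exact: cvg_id].
move=> yS; near (0 : R)^'+ => e.
have e0 : 0 < e by near: e; exact: nbhs_right_gt.
have [y0 yi0] : simplex m 1 (y e) by near: e.
have E : (1 + e) * 1 + (1 - (1 + e)) * 1 = 1 by ring.
split=> [|i].
  have := apex_coord_conv m (1 + e) 1 1 x p; rewrite E => ye.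
  by move: y0; rewrite /y ye; nra.
have := base_coord_conv m (1 + e) 1 1 x p i; rewrite E => ye.
by move: (yi0 i) (pi0 i); rewrite /y ye; nra.
Unshelve. all: by end_near. Qed.

Lemma setD_boundary (R : realType) (d : nat) (A : set 'rV[R]_d) :
  A `\` boundary A = A°.
Proof.
apply/seteqP; split=> [x [Ax nb]|x xA].
  by apply: contrapT => nxA; apply: nb; split=> //; exact: subset_closure.
by split; [exact: interior_subset | case].
Qed.

(** * Lattice points: finiteness, and emptiness of small open dilates *)

Lemma finite_lattice_box (R : realType) (d t : nat) :
  finite_set [set x : 'rV[R]_d | lattice x /\ forall i, `|x ord0 i| <= t%:R].
Proof.
pose f (g : {ffun 'I_d -> 'I_(t + t).+1}) : 'rV[R]_d := \row_i ((g i)%:R - t%:R).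
apply: (@sub_finite_set _ _ (range f)); last first.
  by apply: finite_image; exact: finite_finset.
move=> x [Zx xt].
have xN i : exists n : 'I_(t + t).+1, x ord0 i = n%:R - t%:R.
  have /ler_normlP[lo hi] := xt i.
  have : x ord0 i + t%:R \is a Num.nat.
    rewrite natrEint; apply/andP; split; last by rewrite -subr_ge0 -?opprD; lra.
    by apply: rpredD; [exact: Zx | exact: rpred_nat].
  case/natrP => n nE.
  have nt : (n < (t + t).+1)%N by rewrite ltnS -(ler_nat R) natrD -nE; lra.
  by exists (Ordinal nt); rewrite /= -nE addrK.
have [g gE] := choice xN.
by exists (finfun g) => //; apply/rowP => i; rewrite mxE ffunE gE.
Qed.

(** All barycentric coordinates lie between 0 and [t], and each [x_i] is one of them or a difference
    of two, so [t] bounds its absolute value. *)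
Lemma finite_simplex_lattice (R : realType) (d m t : nat) : (m <= d)%N ->
  finite_set (simplex m t%:R `&` @lattice R d).
Proof.
move=> md; apply: (sub_finite_set _ (@finite_lattice_box R d t)) => x [[b0 a0] Zx].
split=> // i; have := sum_base_coord t%:R x md.
have : base_coord m t%:R x i <= \sum_j base_coord m t%:R x j.
  by rewrite (bigD1 i)//= lerDl sumr_ge0.
move: (a0 i) b0; rewrite {1 2}/base_coord.
by case: (i < m)%N => /=; rewrite ?mul1r ?mul0r ler_norml; lra.
Qed.

Lemma open_simplex_lattice_empty (R : realType) (d m t : nat) :
  (m <= d)%N -> (t <= d - m)%N ->
  open_simplex m t%:R `&` @lattice R d = set0.
Proof.
move=> md tdm; apply/seteqP; split=> // x [[b0 a0] Zx].
have := sum_base_coord t%:R x md.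
(* A base coordinate of index at least [m] is the integer [x_i], hence at least 1 once positive; the
   others are only bounded by 0. The positive apex coordinate then makes the total exceed
   [d - m]. *)
have : \sum_(i < d) (1 - (i < m)%:R) <= \sum_i base_coord m t%:R x i.
  apply: ler_sum => i _; move: (a0 i); rewrite /base_coord.
  case: (i < m)%N => /= [/ltW|]; first by rewrite subrr.
  rewrite subr0 mul0r addr0; have /intrP[z ->] := Zx i.
  by rewrite -[1]/(1%:~R) ler_int ltr0z.
rewrite sumrB sum_ltn_ord// sumr_const card_ord -natrB//.
have : t%:R <= (d - m)%:R :> R by rewrite ler_nat.
by lra.
Qed.

(** * Comparing lattice points of different simplices *)

(* [level] is the [q] of the header; [relevel] translates by
   [q (e_1 + ... + e_a) - q (e_1 + ... + e_b)]. *)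
Definition level (R : realType) (d m : nat) (t : R) (x : 'rV[R]_d) : R :=
  (Num.floor (apex_coord m t x))%:~R.

Definition relevel (R : realType) (d a b : nat) (t : R) (x : 'rV[R]_d) :
    'rV[R]_d :=
  \row_i (x ord0 i + ((i < a)%:R - (i < b)%:R) * level a t x).

Lemma level_itv (R : realType) (d m : nat) (t : R) (x : 'rV[R]_d) :
  0 <= apex_coord m t x - level m t x < 1.
Proof.
rewrite /level subr_ge0 ltrBlDl -[X in _ + X]/(1%:~R) -intrD.
exact: floor_itv.
Qed.

Lemma level_unique (R : realType) (d m : nat) (t q : R) (x : 'rV[R]_d) :
  q \is a Num.int -> 0 <= apex_coord m t x - q < 1 -> level m t x = q.
Proof.
case/intrP=> z -> /andP[lo hi]; congr _%:~R; apply: floor_def.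
by rewrite intrD -[X in _ + X]/1; apply/andP; split; lra.
Qed.

(** The fractional part of the apex coordinate is less than 1 and the rest of each base coordinate
    is an integer, so dropping that part does not change the sign condition. *)
Lemma simplex_level (R : realType) (d m : nat) (t : R) (x : 'rV[R]_d) :
  lattice x -> simplex m t x <->
  0 <= level m t x /\ forall i : 'I_d, 0 <= x ord0 i + (i < m)%:R * level m t x.
Proof.
move=> Zx; have /andP[lo hi] := level_itv m t x.
have qE : level m t x = (Num.floor (apex_coord m t x))%:~R by [].
split=> -[b0 a0]; split=> [|i].
- by rewrite qE ler0z floor_ge_int.
- move: (a0 i); rewrite /base_coord qE; case: (i < m)%N; last by rewrite !mul0r.
  rewrite !mul1r -qE; have /intrP[z zE] := Zx i; rewrite zE => a1.
  have : -1 < z%:~R + level m t x by lra.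
  by rewrite qE -intrD -[-1]/((-1)%:~R) ltr_int -lezD1 addNr ler0z.
- by lra.
- move: (a0 i); rewrite /base_coord; case: (i < m)%N; rewrite ?mul0r// !mul1r.
  by lra.
Qed.

(** The translation preserves the residue [c = t - \sum_i x_i - (a+1) q], and [q] is still the level
    for [b] as soon as [c < b+1]. *)
Lemma level_relevel (R : realType) (d a b : nat) (t : R) (x : 'rV[R]_d) :
  (a <= d)%N -> (b <= d)%N ->
  a.+1%:R * (apex_coord a t x - level a t x) < b.+1%:R ->
  level b t (relevel a b t x) = level a t x.
Proof.
move=> ad bd; set q := level a t x => ab.
have bpos : 0 < b.+1%:R :> R by rewrite ltr0n.
apply: level_unique; first by rewrite intr_int.
have -> : apex_coord b t (relevel a b t x) - q =
    (a.+1%:R * (apex_coord a t x - q)) / b.+1%:R.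
  rewrite {1}/apex_coord.
  have -> : \sum_i relevel a b t x ord0 i =
      \sum_i x ord0 i + (a%:R - b%:R) * q.
    rewrite -(sum_ltn_ord R ad) -(sum_ltn_ord R bd) -sumrB mulr_suml -big_split.
    by apply: eq_bigr => i _; rewrite mxE.
  rewrite /apex_coord -!natr1; field.
  by rewrite !natr1 !pnatr_eq0.
have /andP[lo _] := level_itv a t x.
by rewrite divr_ge0 ?mulr_ge0//= ltr_pdivrMr// mul1r.
Qed.

Lemma relevelK (R : realType) (d a b : nat) (t : R) (x : 'rV[R]_d) :
  level b t (relevel a b t x) = level a t x ->
  relevel b a t (relevel a b t x) = x.
Proof. by move=> E; apply/rowP => i; rewrite !mxE E; ring. Qed.

Lemma lattice_relevel (R : realType) (d a b : nat) (t : R) (x : 'rV[R]_d) :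
  lattice x -> lattice (relevel a b t x).
Proof.
move=> Zx i; rewrite mxE rpredD ?Zx// rpredM ?intr_int//.
by rewrite rpredB ?rpred_nat.
Qed.

Lemma simplex_relevel (R : realType) (d a b : nat) (t : R) (x : 'rV[R]_d) :
  lattice x -> level b t (relevel a b t x) = level a t x ->
  simplex b t (relevel a b t x) <-> simplex a t x.
Proof.
move=> Zx E; rewrite !simplex_level ?E//; last exact: lattice_relevel.
have H i : relevel a b t x ord0 i + (i < b)%:R * level a t x =
           x ord0 i + (i < a)%:R * level a t x by rewrite mxE; ring.
by split=> -[q0 xi0]; split=> // i; move: (xi0 i); rewrite H.
Qed.

(** The residue is [t] minus [q] and minus the quantities [x_i + (i < m) q], all non-negative by
    [simplex_level]. *)
Lemma residue_le (R : realType) (d m : nat) (t : R) (x : 'rV[R]_d) :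
  (m <= d)%N -> lattice x -> simplex m t x ->
  m.+1%:R * (apex_coord m t x - level m t x) <= t.
Proof.
move=> md Zx /(simplex_level _ _ Zx)[q0 xi0].
have : 0 <= \sum_i (x ord0 i + (i < m)%:R * level m t x) by apply: sumr_ge0.
rewrite big_split/= -mulr_suml sum_ltn_ord// mulrBr [_ * apex_coord _ _ _]mulrC.
rewrite divfK ?pnatr_eq0// -natr1; lra.
Qed.

(** Going up, the condition of [level_relevel] is automatic: the residue is below [a+1], hence below
    [b+1]. *)
Lemma level_relevel_le (R : realType) (d a b : nat) (t : R) (x : 'rV[R]_d) :
  (a <= b <= d)%N -> level b t (relevel a b t x) = level a t x.
Proof.
case/andP=> ab bd; apply: level_relevel => //; first exact: leq_trans bd.
have /andP[lo hi] := level_itv a t x.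
have : a.+1%:R <= b.+1%:R :> R by rewrite ler_nat.
have : 0 < a.+1%:R :> R by rewrite ltr0n.
by nra.
Qed.

Lemma relevel_inj (R : realType) (d a b : nat) (t : R) (A : set 'rV[R]_d) :
  (a <= b <= d)%N -> {in A &, injective (relevel a b t)}.
Proof.
move=> abd; suff K : cancel (relevel a b t) (@relevel R d b a t).
  by move=> x y _ _; exact: (can_inj K).
by move=> x; apply/relevelK/level_relevel_le.
Qed.


(** * The simplices as integral polytopes, and their counts *)

Lemma vertices_lattice (R : realType) (d m : nat) :
  @vertices R d m `<=` @lattice R d.
Proof.
by move=> _ [->|[i _ <-]] j; rewrite mxE ?rpredN rpred_nat.
Qed.

Lemma integral_simplex (R : realType) (d m : nat) : (m <= d)%N ->
  integral_convex_polytope (simplex m 1 : set 'rV[R]_d).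
Proof.
move=> md; rewrite -convex_hull_vertices//; split.
  exists (@vertices R d m); split=> //.
  rewrite finite_setU; split; first exact: finite_set1.
  by apply: finite_image; exact: finite_finset.
exact: subset_trans (@vertex_convex_hull _ _ _) (@vertices_lattice _ _ _).
Qed.

Lemma has_dim_simplex (R : realType) (d m : nat) : (m <= d)%N ->
  has_dim (simplex m 1 : set 'rV[R]_d) d.
Proof.
move=> md; exists 0, fullv; split; last by rewrite dimvf; exact: mul1n.
rewrite (affine_hull_vertices md); last first.
  by rewrite -convex_hull_vertices//; exact: sub_smallest.
by apply/seteqP; split=> // x _; exists x; rewrite ?add0r//= memvf.
Qed.

Lemma ehrhart_simplex (R : realType) (d m t : nat) : (0 < t)%N ->
  ehrhart (simplex m 1 : set 'rV[R]_d) t =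
  lattice_count (simplex m t%:R : set 'rV[R]_d).
Proof. by move=> t0; rewrite /ehrhart dilate_simplex. Qed.

Lemma ehrhart_int_simplex (R : realType) (d m t : nat) :
  (m <= d)%N -> (0 < t)%N ->
  ehrhart_int (simplex m 1 : set 'rV[R]_d) t =
  lattice_count (open_simplex m t%:R : set 'rV[R]_d).
Proof.
by move=> md t0; rewrite /ehrhart_int setD_boundary interior_simplex//
  dilate_open_simplex.
Qed.

Lemma ehrhart_int_simplex_eq0 (R : realType) (d m t : nat) :
  (m <= d)%N -> (0 < t <= d - m)%N ->
  ehrhart_int (simplex m 1 : set 'rV[R]_d) t = 0%N.
Proof.
move=> md /andP[t0 tdm]; rewrite ehrhart_int_simplex// /lattice_count.
by rewrite open_simplex_lattice_empty// fset_set0 cardfs0.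
Qed.

Lemma ehrhart_int_simplex_neq0 (R : realType) (d m : nat) : (m <= d)%N ->
  ehrhart_int (simplex m 1 : set 'rV[R]_d) (d - m).+1 <> 0%N.
Proof.
move=> md; rewrite ehrhart_int_simplex// => /cardfs0_eq /fset_set_set0 E.
suff : (set0 : set 'rV[R]_d) (first_interior_point R d m) by [].
rewrite -E.
  by split; [exact: first_interior_pointP | move=> i; rewrite mxE rpred_nat].
(* A zero count gives an empty set only for finite sets, as [fset_set] sends infinite ones to
   [fset0]. *)
apply: (sub_finite_set _ (@finite_simplex_lattice R d m (d - m).+1 md)).
by move=> x [[/ltW b0 a0] Zx]; split=> //; split=> // i; exact/ltW.
Qed.

Lemma relevel_simplex_sub (R : realType) (d a b : nat) (t : R) :
  (a <= b <= d)%N ->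
  relevel a b t @` (simplex a t `&` @lattice R d)
    `<=` simplex b t `&` @lattice R d.
Proof.
move=> abd _ [x [Sx Zx] <-]; split; last exact: lattice_relevel.
by apply/simplex_relevel => //; exact: level_relevel_le.
Qed.

(** Counting the image instead places both counts inside [t S_b], where they are compared by
    inclusion. *)
Lemma lattice_count_relevel (R : realType) (d a b t : nat) : (a <= b <= d)%N ->
  #|` fset_set (relevel a b t%:R @` (simplex a t%:R `&` @lattice R d))| =
  lattice_count (simplex a t%:R : set 'rV[R]_d).
Proof.
move=> abd; have /andP[ab bd] := abd.
have fin := @finite_simplex_lattice R d a t (leq_trans ab bd).
apply/fcard_eq => //; first exact: finite_image.
exact/inj_card_eq/relevel_inj.
Qed.

Lemma ehrhart_simplex_eq (R : realType) (d a b t : nat) :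
  (a <= b <= d)%N -> (0 < t <= a)%N ->
  ehrhart (simplex a 1 : set 'rV[R]_d) t = ehrhart (simplex b 1 : set 'rV[R]_d) t.
Proof.
move=> abd /andP[t0 ta]; have /andP[ab bd] := abd; have ad := leq_trans ab bd.
rewrite !ehrhart_simplex// -(lattice_count_relevel _ _ abd).
congr #|` fset_set _|; apply/seteqP; split; first exact: relevel_simplex_sub.
move=> x [Sx Zx].
(* Going down needs a residue below [a+1], which holds because it is at most [t <= a]. *)
have lE : level a t%:R (relevel b a t%:R x) = level b t%:R x.
  apply: level_relevel => //; apply: le_lt_trans (residue_le bd Zx Sx) _.
  by rewrite ltr_nat ltnS.
exists (relevel b a t%:R x); last exact: relevelK.
by split; [exact/simplex_relevel | exact: lattice_relevel].
Qed.

Lemma ehrhart_simplex_neq (R : realType) (d a b : nat) : (a < b <= d)%N ->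
  ehrhart (simplex a 1 : set 'rV[R]_d) a.+1 <>
  ehrhart (simplex b 1 : set 'rV[R]_d) a.+1.
Proof.
case/andP=> ab bd; have abd : (a <= b <= d)%N by rewrite ltnW.
rewrite !ehrhart_simplex// -(lattice_count_relevel _ _ abd) => E.
have fin := @finite_simplex_lattice R d b a.+1 bd.
have sub := @relevel_simplex_sub R d a b a.+1%:R abd.
have := sub; rewrite fset_set_sub//; last exact: sub_finite_set fin.
have apex0 m : apex_coord m a.+1%:R (0 : 'rV[R]_d) = a.+1%:R / m.+1%:R.
  by rewrite /apex_coord big1 ?subr0// => i _; rewrite mxE.
(* Here [a < b] enters: the apex coordinate [(a+1) / (b+1)] of the origin is less than 1. *)
have lev0 : level b a.+1%:R (0 : 'rV[R]_d) = 0.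
  apply: level_unique; first exact: rpred0.
  by rewrite apex0 subr0 divr_ge0//= ltr_pdivrMr ?ltr0n// mul1r ltr_nat.
(* Equal counts would turn the inclusion into an equality, so the origin would be an image. *)
move/(fsubset_cardP E)/(_ 0); rewrite !in_fset_set//; last first.
  exact: sub_finite_set fin.
have S0 : (simplex b a.+1%:R `&` @lattice R d) 0.
  split; last by move=> i; rewrite mxE rpred0.
  split=> [|i]; rewrite /base_coord apex0 ?mxE ?add0r ?mulr_ge0 ?divr_ge0//.
rewrite [RHS]mem_set// => /set_mem[x [Sx Zx] x0].
have lE := level_relevel_le a.+1%:R x abd.
have xE : x = 0.
  have := relevelK lE; rewrite x0 => <-.
  by apply/rowP => i; rewrite !mxE lev0 mulr0 addr0.
(* The origin would have level 0 for [a], but its apex coordinate there is exactly 1. *)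
move: lE; rewrite x0 lev0 xE => l0.
by have := level_itv a a.+1%:R (0 : 'rV[R]_d);
   rewrite -l0 subr0 apex0 mulfV ?pnatr_eq0// ltxx andbF.
Qed.

Theorem theorem0p2 (R : realType) (d : nat) (hd : (1 <= d)%N) (k l : nat)
    (hkl : (k + l <= d - 1)%N) :
  exists P Q : set 'rV[R]_d,
    (integral_convex_polytope P /\ has_dim P d) /\
    (integral_convex_polytope Q /\ has_dim Q d) /\
    (forall t : nat, (1 <= t <= k)%N -> ehrhart P t = ehrhart Q t) /\
    (forall t : nat, (1 <= t <= l)%N -> ehrhart_int P t = ehrhart_int Q t) /\
    (ehrhart P k.+1 <> ehrhart Q k.+1 /\
     ehrhart_int P l.+1 <> ehrhart_int Q l.+1).
Proof.
have kld : (k + l < d)%N by rewrite (leq_ltn_trans hkl)// subn1 prednK.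
have ld : (l <= d)%N by exact: leq_trans (leq_addl k l) (ltnW kld).
have kd : (k <= d)%N by exact: leq_trans (leq_addr l k) (ltnW kld).
have k_lt : (k < d - l)%N by rewrite ltn_subRL addnC.
have l_lt : (l < d - k)%N by rewrite ltn_subRL.
exists (simplex k 1), (simplex (d - l) 1).
split; first by split; [exact: integral_simplex | exact: has_dim_simplex].
split.
  by split; [exact/integral_simplex/leq_subr | exact/has_dim_simplex/leq_subr].
split=> [t tk|]; first by apply: ehrhart_simplex_eq; rewrite // ltnW//= leq_subr.
split=> [t /andP[t0 tl]|].
  (* Both interior counts vanish, since [t <= l < d - k] and [t <= l = d - (d - l)]. *)
  rewrite !ehrhart_int_simplex_eq0 ?leq_subr// t0/= ?subKn//.
  exact: leq_trans (ltnW l_lt).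
split; first by apply: ehrhart_simplex_neq; rewrite k_lt leq_subr.
(* As [l + 1 <= d - k], the count for [S_k] is still 0, whereas [l + 1] is the first factor giving
   [S_(d-l)] an interior lattice point. *)
rewrite (ehrhart_int_simplex_eq0 R kd) ?l_lt// => /esym.
by have := @ehrhart_int_simplex_neq0 R d (d - l) (leq_subr _ _); rewrite subKn.
Qed.
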